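(* Let $\mu_1,\mu_2\in[-\pi,\pi)$, $\kappa_1,\kappa_2\ge 0$, $\kappa_3\in\mathbb{R}$, and let $(\Theta,\Phi)$ have the bivariate von Mises sine distribution with parameters $\kappa_1,\kappa_2,\kappa_3,\mu_1,\mu_2$. Write $C_s=C_s(\kappa_1,\kappa_2,\kappa_3)$ for the reciprocal of its normalizing constant; all partial derivatives below are evaluated at $(\kappa_1,\kappa_2,\kappa_3)$. Then: 1. The Fisher-Lee circular correlation coefficient between $\Theta$ and $\Phi$ is $$\rho_{\mathrm{FL}}(\Theta,\Phi)=\frac{\left(\frac{1}{C_s}\frac{\partial C_s}{\partial\kappa_3}\right)\left(\frac{1}{C_s}\frac{\partial^2 C_s}{\partial\kappa_1\partial\kappa_2}\right)}{\sqrt{\left(\frac{1}{C_s}\frac{\partial^2 C_s}{\partial\kappa_1^2}\right)\left(1-\frac{1}{C_s}\frac{\partial^2 C_s}{\partial\kappa_1^2}\right)\left(\frac{1}{C_s}\frac{\partial^2 C_s}{\partial\kappa_2^2}\right)\left(1-\frac{1}{C_s}\frac{\partial^2 C_s}{\partial\kappa_2^2}\right)}}.$$ 2. The Jammalamadaka-Sarma circular correlation coefficient between $\Theta$ and $\Phi$ is $$\rho_{\mathrm{JS}}(\Theta,\Phi)=\frac{\frac{1}{C_s}\frac{\partial C_s}{\partial\kappa_3}}{\sqrt{\left(1-\frac{1}{C_s}\frac{\partial^2 C_s}{\partial\kappa_1^2}\right)\left(1-\frac{1}{C_s}\frac{\partial^2 C_s}{\partial\kappa_2^2}\right)}}.$$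 3. The circular variances of $\Theta$ and $\Phi$ are $$\operatorname{var}(\Theta)=1-\frac{1}{C_s}\frac{\partial C_s}{\partial\kappa_1},\qquad \operatorname{var}(\Phi)=1-\frac{1}{C_s}\frac{\partial C_s}{\partial\kappa_2}.$$
   Context: The bivariate von Mises sine distribution with parameters $\kappa_1,\kappa_2\ge0$, $\kappa_3\in\mathbb{R}$, $\mu_1,\mu_2\in[-\pi,\pi)$ is the distribution on $[-\pi,\pi)^2$ with density $$f(\theta,\phi)=C_s(\kappa_1,\kappa_2,\kappa_3)^{-1}\exp[\kappa_1\cos(\theta-\mu_1)+\kappa_2\cos(\phi-\mu_2)+\kappa_3\sin(\theta-\mu_1)\sin(\phi-\mu_2)],$$ where $$C_s(\kappa_1,\kappa_2,\kappa_3)=\int_{-\pi}^{\pi}\int_{-\pi}^{\pi}\exp(\kappa_1\cos\theta+\kappa_2\cos\phi+\kappa_3\sin\theta\sin\phi)\,d\theta\,d\phi=4\pi^2\sum_{m=0}^\infty\binom{2m}{m}\left(\frac{\kappa_3^2}{4\kappa_1\kappa_2}\right)^m I_m(\kappa_1)I_m(\kappa_2).$$ Here $I_m$ is the modified Bessel function of the first kind of order $m$, and the terms of the series are read as limits when $\kappa_1$ or $\kappa_2$ is zero. Through the integral, $C_s$ is a smooth function on $\mathbb{R}^3$, and this gives meaning to its partial derivatives also at $\kappa_1=0$ or $\kappa_2=0$. Fisher-Lee coefficient: with $(\Theta_1,\Phi_1),(\Theta_2,\Phi_2)$ i.i.d. copies of $(\Theta,\Phi)$, $$\rho_{\mathrm{FL}}(\Theta,\Phi)=\frac{E[\sin(\Theta_1-\Theta_2)\sin(\Phi_1-\Phi_2)]}{\sqrt{E[\sin^2(\Theta_1-\Theta_2)]\,E[\sin^2(\Phi_1-\Phi_2)]}}.$$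 Jammalamadaka-Sarma coefficient: $$\rho_{\mathrm{JS}}(\Theta,\Phi)=\frac{E[\sin(\Theta-\mu_1)\sin(\Phi-\mu_2)]}{\sqrt{E[\sin^2(\Theta-\mu_1)]\,E[\sin^2(\Phi-\mu_2)]}},$$ where the location parameters $\mu_1,\mu_2$ of the model serve as the circular means of $\Theta,\Phi$. Circular variance: $\operatorname{var}(\Theta)=1-E[\cos(\Theta-\mu_1)]$ and $\operatorname{var}(\Phi)=1-E[\cos(\Phi-\mu_2)]$. *)

(* Defs.v *)
From HB Require Import structures.
From mathcomp Require Import all_boot all_order all_algebra.
From mathcomp Require Import all_classical all_reals all_analysis.

Set Implicit Arguments.
Unset Strict Implicit.
Unset Printing Implicit Defensive.

Import Order.TTheory GRing.Theory Num.Theory.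
Import numFieldNormedType.Exports.

Local Open Scope classical_set_scope.
Local Open Scope ring_scope.

Section von_mises_sine.
Variable R : realType.

Definition vms_exponent (k1 k2 k3 t p : R) : R :=
  k1 * cos t + k2 * cos p + k3 * (sin t * sin p).

(* Defined on all of R^3, so that its two-sided partial derivatives make sense
   at k1 = 0 and k2 = 0. *)
Definition Cs (k1 k2 k3 : R) : R :=
  \int[lebesgue_measure]_(p in `[- pi, pi])
    \int[lebesgue_measure]_(t in `[- pi, pi])
      expR (vms_exponent k1 k2 k3 t p).

Definition vms_density (k1 k2 k3 mu1 mu2 : R) (z : R * R) : R :=
  (Cs k1 k2 k3)^-1 * expR (vms_exponent k1 k2 k3 (z.1 - mu1) (z.2 - mu2)).

Definition vms_support : set (R * R) := `[- pi, pi[ `*` `[- pi, pi[.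

Definition vms_distributed d (T : measurableType d) (P : probability T R)
    (Z : {RV P >-> (R * R)%type}) (k1 k2 k3 mu1 mu2 : R) : Prop :=
  forall A : set (R * R), measurable A ->
    distribution P Z A =
    (\int[(@lebesgue_measure R \x @lebesgue_measure R)%E]_(z in A `&` vms_support)
      (vms_density k1 k2 k3 mu1 mu2 z)%:E)%E.

End von_mises_sine.

(* derive1 is total, and is the true derivative only where the slice is
   derivable; Cs is smooth, so this is so for all the iterates used on it. *)
Section partial_derivatives.
Variable R : realType.
Implicit Type f : R -> R -> R -> R.

Definition partial1 f : R -> R -> R -> R :=
  fun x y z => derive1 (fun u => f u y z) x.
Definition partial2 f : R -> R -> R -> R :=
  fun x y z => derive1 (fun u => f x u z) y.
Definition partial3 f : R -> R -> R -> R :=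
  fun x y z => derive1 (fun u => f x y u) z.

End partial_derivatives.

Section circular_statistics.
Context d (T : measurableType d) (R : realType) (P : probability T R).

(* Real-valued expectation: below it is only applied to bounded variables, whose
   extended-real expectation is finite. *)
Definition rexpectation (X : T -> R) : R := fine 'E_P[X]%E.

Definition circular_variance (mu : R) (X : T -> R) : R :=
  1 - rexpectation (fun w => cos (X w - mu)).

Definition jammalamadaka_sarma (mu1 mu2 : R) (X Y : T -> R) : R :=
  rexpectation (fun w => sin (X w - mu1) * sin (Y w - mu2)) /
  Num.sqrt (rexpectation (fun w => sin (X w - mu1) ^+ 2) *
            rexpectation (fun w => sin (Y w - mu2) ^+ 2)).

(* The Fisher-Lee coefficient, computed from two copies (X1, Y1), (X2, Y2). *)
Definition fisher_lee (X1 Y1 X2 Y2 : T -> R) : R :=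
  rexpectation (fun w => sin (X1 w - X2 w) * sin (Y1 w - Y2 w)) /
  Num.sqrt (rexpectation (fun w => sin (X1 w - X2 w) ^+ 2) *
            rexpectation (fun w => sin (Y1 w - Y2 w) ^+ 2)).

End circular_statistics.

Section iid.
Context d (T : measurableType d) d' (T' : measurableType d')
  d0 (S : measurableType d0) (R : realType)
  (P : probability T R) (Q : probability T' R).

Definition independent_rv (Z1 Z2 : {RV Q >-> S}) : Prop :=
  forall A B : set S, measurable A -> measurable B ->
    Q (Z1 @^-1` A `&` Z2 @^-1` B) = (Q (Z1 @^-1` A) * Q (Z2 @^-1` B))%E.

Definition same_distribution (Z1 : {RV Q >-> S}) (Z : {RV P >-> S}) : Prop :=
  forall A : set S, measurable A -> distribution Q Z1 A = distribution P Z A.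

(* The copies may live on another probability space than Z, since that of Z need
   not carry two independent copies of it. *)
Definition iid_copies (Z : {RV P >-> S}) (Z1 Z2 : {RV Q >-> S}) : Prop :=
  [/\ same_distribution Z1 Z, same_distribution Z2 Z & independent_rv Z1 Z2].

End iid.

Lemma iid_copies_exist d (T : measurableType d) d0 (S : measurableType d0)
    (R : realType) (P : probability T R) (Z : {RV P >-> S}) :
  exists (d' : measure_display) (T' : measurableType d') (Q : probability T' R)
    (Z1 Z2 : {RV Q >-> S}), iid_copies Z Z1 Z2.
Proof.
pose Q : probability (T * T)%type R := (P \x P)%E.
have m1 : measurable_fun [set: T * T] (Z \o fst) by exact: measurableT_comp.
have m2 : measurable_fun [set: T * T] (Z \o snd) by exact: measurableT_comp.
pose i1 := isMeasurableFun.Build _ _ _ _ (Z \o fst) m1.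
pose i2 := isMeasurableFun.Build _ _ _ _ (Z \o snd) m2.
pose Z1 : {RV Q >-> S} := HB.pack (Z \o fst) i1.
pose Z2 : {RV Q >-> S} := HB.pack (Z \o snd) i2.
exists _, (T * T)%type, Q, Z1, Z2.
have mZ (A : set S) : measurable A -> measurable (Z @^-1` A).
  by move=> mA; rewrite -[X in measurable X]setTI; exact: measurable_funPT.
have QX (A B : set T) : measurable A -> measurable B ->
    Q (A `*` B) = (P A * P B)%E.
  by move=> mA mB; exact: product_measure1E.
have Q1 A : measurable A -> Q (Z1 @^-1` A) = P (Z @^-1` A).
  move=> mA; have -> : Z1 @^-1` A = (Z @^-1` A) `*` setT.
    by apply/seteqP; split => -[x y] //= [].
  by rewrite QX ?probability_setT ?mule1//; exact: mZ.
have Q2 A : measurable A -> Q (Z2 @^-1` A) = P (Z @^-1` A).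
  move=> mA; have -> : Z2 @^-1` A = setT `*` (Z @^-1` A).
    by apply/seteqP; split => -[x y] //= [].
  by rewrite QX ?probability_setT ?mul1e//; exact: mZ.
split; [exact: Q1|exact: Q2|].
move=> A B mA mB; rewrite Q1// Q2//.
by rewrite -QX//; exact: mZ.
Qed.

(* Main.v *)
(* Write C for the normalizing constant and w for the unnormalized density. By
   Fubini and 2 pi-periodicity, the expectation of h(Theta - mu1, Phi - mu2) is
   1/C times the integral of h w over the square, and differentiating under the
   integral sign multiplies the integrand by cos theta, cos phi or
   sin theta sin phi; this identifies the moments with derivatives of C. Since w
   is invariant under (theta, phi) -> (- theta, - phi), the moments of
   sin theta cos theta, sin phi cos phi and sin theta cos phi vanish. Expanding
   sin(x1 - x2) by the subtraction formula, each expectation in the Fisher-Lee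
   coefficient is twice a 2 x 2 determinant of moments of one copy, whose
   off-diagonal product is zero. *)
Require Import Defs.
From HB Require Import structures.
From mathcomp Require Import all_boot all_order all_algebra.
From mathcomp Require Import all_classical all_reals all_analysis.
From mathcomp Require Import measurable_realfun ring lra.
Import Order.TTheory GRing.Theory Num.Theory.
Import numFieldNormedType.Exports.
Local Open Scope classical_set_scope.
Local Open Scope ring_scope.

(** * Bounded measurable functions, the class containing every integrand used *)

Section bounded_measurable.
Context {R : realType} {d : measure_display} {T : measurableType d}.
Implicit Types (f g : T -> R) (mu : {measure set T -> \bar R}) (D : set T).

(** The bound is pointwise rather than almost everywhere, so the class is stable under sums,
    products, [expR] and composition with any measurable map (slices, shifts, random variables), and
    its members are integrable on every set of finite measure. *)
Definition bounded_measurable f :=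
  measurable_fun setT f /\ exists M : R, forall x, `|f x| <= M.

Lemma bounded_measurable_cst c : bounded_measurable (fun=> c).
Proof. by split => //; exists `|c|. Qed.

Lemma bounded_measurableD {f g} : bounded_measurable f ->
  bounded_measurable g -> bounded_measurable (fun x => f x + g x).
Proof.
move=> [mf [M fM]] [mg [N gN]]; split; first exact: measurable_funD.
by exists (M + N) => x; rewrite (le_trans (ler_normD _ _))// lerD.
Qed.

Lemma bounded_measurableM {f g} : bounded_measurable f ->
  bounded_measurable g -> bounded_measurable (fun x => f x * g x).
Proof.
move=> [mf [M fM]] [mg [N gN]]; split; first exact: measurable_funM.
by exists (M * N) => x; rewrite normrM ler_pM.
Qed.

Lemma bounded_measurable_expR {f} : bounded_measurable f ->
  bounded_measurable (fun x => expR (f x)).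
Proof.
move=> [mf [M fM]]; split; first exact: measurableT_comp.
exists (expR M) => x; rewrite ger0_norm ?expR_ge0// ler_expR.
by rewrite (le_trans (ler_norm _)).
Qed.

Lemma bounded_measurable_sin {f} : measurable_fun setT f ->
  bounded_measurable (fun x => sin (f x)).
Proof.
move=> mf; split; last first.
  by exists 1 => x; rewrite ler_norml sin_geN1 sin_le1.
apply: measurableT_comp mf => //.
by apply: continuous_measurable_fun; exact: continuous_sin.
Qed.

Lemma bounded_measurable_cos {f} : measurable_fun setT f ->
  bounded_measurable (fun x => cos (f x)).
Proof.
move=> mf; split; last first.
  by exists 1 => x; rewrite ler_norml cos_geN1 cos_le1.
apply: measurableT_comp mf => //.
by apply: continuous_measurable_fun; exact: continuous_cos.
Qed.

Lemma bounded_measurable_integrable {mu D f} : measurable D ->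
  (mu D < +oo)%E -> bounded_measurable f -> mu.-integrable D (EFin \o f).
Proof.
move=> mD muD [mf [M fM]]; apply: measurable_bounded_integrable => //.
  exact: measurable_funTS.
exists M; split; first exact: num_real.
move=> x Mx y _; exact: le_trans (fM y) (ltW Mx).
Qed.

End bounded_measurable.

Lemma bounded_measurable_comp {R : realType} {d d' : measure_display}
    {T : measurableType d} {T' : measurableType d'}
    {f : T' -> R} {g : T -> T'} :
  bounded_measurable f -> measurable_fun setT g ->
  bounded_measurable (fun x => f (g x)).
Proof.
by move=> [mf [M fM]] mg; split; [exact: measurableT_comp|exists M].
Qed.

(** * Differentiation under the integral sign *)

(** An exponent affine in the parameter covers all three partial derivatives of [Cs], and the factor
    [h] allows iteration, since one derivative only replaces [h] by [h * a]. Near [x] the derivative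
    of the integrand is dominated by a constant, integrable because [D] has finite measure. *)
Lemma derive1_integral_expR {R : realType} {d : measure_display}
    {T : measurableType d} {mu : {measure set T -> \bar R}} {D : set T}
    {h a b : T -> R} (x : R) : measurable D -> (mu D < +oo)%E ->
  bounded_measurable h -> bounded_measurable a -> bounded_measurable b ->
  derive1 (fun u => \int[mu]_(z in D) (h z * expR (u * a z + b z))) x =
  \int[mu]_(z in D) (h z * a z * expR (x * a z + b z)).
Proof.
move=> mD muD bh ba bb.
pose f u z := h z * expR (u * a z + b z).
have df u z : is_derive u (1 : R) (f ^~ z) (h z * a z * expR (u * a z + b z)).
  rewrite /f; apply: is_derive_eq.
  by rewrite /= /GRing.scale /=; ring.
have d1f u z : partial1of2 f u z = h z * a z * expR (u * a z + b z).
  by rewrite partial1of2E derive_val.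
have [_ [Mh hM]] := bh; have [_ [Ma aM]] := ba; have [_ [Mb bM]] := bb.
have Mh0 (z : T) : 0 <= Mh by rewrite (le_trans _ (hM z)).
(* For [u] in []x - 1, x + 1[] one has [|u| <= |x| + 1], whence this bound on the derivative of the
   integrand. The absolute value of [K] is used below so that the dominating function is visibly
   nonnegative. *)
pose K := Mh * Ma * expR ((`|x| + 1) * Ma + Mb).
rewrite (@differentiation_under_integral R _ _ mu f D mD x (x - 1) (x + 1) _ _ _
  (fun=> `|K|)) //=.
- by apply: eq_Rintegral => z _; rewrite d1f.
- by rewrite in_itv/= ltrBlDr andbb ltrDl ltr01.
- move=> u _; apply: bounded_measurable_integrable => //.
  apply: bounded_measurableM => //; apply: bounded_measurable_expR.
  apply: bounded_measurableD => //; apply: bounded_measurableM => //.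
  exact: bounded_measurable_cst.
- by apply: bounded_measurable_integrable => //; exact: bounded_measurable_cst.
- move=> u z + _; rewrite in_itv/= => /andP[u1 u2]; rewrite d1f.
  rewrite (le_trans _ (ler_norm _))// /K !normrM ler_pM//.
    by rewrite ler_pM.
  rewrite ger0_norm ?expR_ge0// ler_expR (le_trans (ler_norm _))//.
  rewrite (le_trans (ler_normD _ _))// lerD// normrM ler_pM//.
  rewrite -[u](subrK x) (le_trans (ler_normD _ _))// addrC lerD2l ler_distl.
  by rewrite !ltW.
Qed.

(** * Translation, reflection and periodicity of integrals over intervals *)

Section circle_integral.
Context {R : realType}.
Local Notation leb := (@lebesgue_measure R).
Implicit Types (g : R -> R) (a b c : R).

(** By uniqueness of Lebesgue measure it is enough to compare the two measures on half-open
    intervals, whose length a translation preserves. *)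
Lemma lebesgue_measure_shift c {A : set (measurableTypeR R)} : measurable A ->
  pushforward leb (fun x => x - c : measurableTypeR R) A = leb A.
Proof.
move=> mA; apply/esym/lebesgue_measure_unique => //.
  exact: measurable_funB.
move=> mshift _ [[a b] _ <-].
have pre : (fun x : R => x - c) @^-1` `]a, b] = `](a + c), (b + c)]%classic.
  by apply/seteqP; split => x /=; rewrite !in_itv/= ltrBrDr lerBlDr.
rewrite [RHS](_ : _ = leb `](a + c), (b + c)]%classic); last by rewrite -pre.
rewrite !lebesgue_measure_itv/= !lte_fin ltrD2r.
by case: ifP => // _; congr (EFin _); ring.
Qed.

Lemma lebesgue_itv_lty (bl br : bool) a b :
  (leb [set` Interval (BSide bl a) (BSide br b)] < +oo)%E.
Proof.
by rewrite lebesgue_measure_itv /=; case: ifP => // _; rewrite -EFinD ltry.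
Qed.

Lemma Rintegral_shift {g} a b c : bounded_measurable g ->
  \int[leb]_(x in `[a, b[) g (x - c) = \int[leb]_(x in `[a - c, b - c[) g x.
Proof.
move=> bg; have mshift : measurable_fun [set: measurableTypeR R]
    (fun x : measurableTypeR R => x - c : measurableTypeR R).
  exact: measurable_funB.
have pre : (fun x : R => x - c) @^-1` `[a - c, b - c[%classic = `[a, b[%classic.
  by apply/seteqP; split => x /=; rewrite !in_itv/= lerD2r ltrD2r.
rewrite /Rintegral -pre; congr fine.
rewrite -(@integral_pushforward _ _ (measurableTypeR R) (measurableTypeR R) _ _
  mshift leb _ (EFin \o g))//.
- apply: eq_measure_integral => A mA _; exact: lebesgue_measure_shift.
- by apply/measurable_EFinP; case: bg.
- rewrite /= pre; apply: (@bounded_measurable_integrable _ _ _ leb _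
    (fun x => g (x - c))) => //.
  + exact: (lebesgue_itv_lty true true a b).
  + exact: (bounded_measurable_comp bg).
Qed.

Lemma Rintegral_oppr {g} a b : bounded_measurable g ->
  \int[leb]_(x in `[a, b[) g (- x) = \int[leb]_(x in `[- b, - a[) g x.
Proof.
move=> bg; have mopp : measurable_fun [set: measurableTypeR R]
    (-%R : measurableTypeR R -> measurableTypeR R).
  exact: oppr_measurable.
have intg bl br x y :
    leb.-integrable [set` Interval (BSide bl x) (BSide br y)] (EFin \o g).
  by apply: bounded_measurable_integrable => //; exact: lebesgue_itv_lty.
(* Reflection carries [[a, b[] to []- b, - a]]; single points are null, so the half-open convention
   can be restored. *)
have -> : \int[leb]_(x in `[- b, - a[) g x = \int[leb]_(x in `]- b, - a]) g x.
  rewrite Rintegral_itv_bndo_bndc; last exact: (intg true true _ _).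
  by rewrite Rintegral_itv_obnd_cbnd//; exact: (intg false false _ _).
have pre : -%R @^-1` `]- b, - a]%classic = `[a, b[%classic.
  by rewrite opp_preimage_itvbndbnd/= !opprK.
rewrite /Rintegral -pre; congr fine.
rewrite -(@integral_pushforward _ _ (measurableTypeR R) (measurableTypeR R) _ _
  mopp leb _ (EFin \o g))//.
- apply: eq_measure_integral => A mA _; exact: lebesgue_measureN.
- by apply/measurable_EFinP; case: bg.
- rewrite /= pre; apply: (@bounded_measurable_integrable _ _ _ leb _
    (fun x => g (- x))) => //.
  + exact: (lebesgue_itv_lty true true a b).
  + exact: (bounded_measurable_comp bg).
Qed.

Lemma Rintegral_itv_cat {g a b c} : bounded_measurable g -> a <= b -> b <= c ->
  \int[leb]_(x in `[a, c[) g x =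
  \int[leb]_(x in `[a, b[) g x + \int[leb]_(x in `[b, c[) g x.
Proof.
move=> bg ab bc; rewrite (@itv_bndbnd_setU _ _ _ (BLeft b))//.
rewrite Rintegral_setU//.
- rewrite -itv_bndbnd_setU//; apply: bounded_measurable_integrable => //.
  exact: (lebesgue_itv_lty true true a c).
- apply/disj_setPS => y [/=]; rewrite 2!in_itv/= => /andP[_ yx] /andP[].
  by rewrite leNgt yx.
Qed.

(** The two windows share [[b, a + p[]; the remaining piece [[a, b[] is carried onto [[a + p, b +
    p[] by a translation by one period. *)
Lemma Rintegral_period_le {g a b p} : bounded_measurable g -> periodic g p ->
  a <= b -> b <= a + p ->
  \int[leb]_(x in `[a, a + p[) g x = \int[leb]_(x in `[b, b + p[) g x.
Proof.
move=> bg pg ab bap.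
rewrite (Rintegral_itv_cat bg ab bap).
rewrite (Rintegral_itv_cat bg bap (_ : a + p <= b + p)) ?lerD2r// addrC.
congr (_ + _).
have := Rintegral_shift (a + p) (b + p) p bg; rewrite !addrK => <-.
by apply: eq_Rintegral => x _; rewrite -[x in RHS](subrK p) pg.
Qed.

Lemma Rintegral_circle_shift {g c} : bounded_measurable g ->
  periodic g (pi *+ 2) -> - pi <= c < pi ->
  \int[leb]_(x in `[- pi, pi[) g (x - c) = \int[leb]_(x in `[- pi, pi[) g x.
Proof.
move=> bg pg /andP[c1 c2]; rewrite Rintegral_shift//.
have -> : pi - c = - pi - c + pi *+ 2 by rewrite mulr2n; ring.
have -> : [set` `[- pi, pi[] = [set` `[- pi, - pi + pi *+ 2[] :> set R.
  by rewrite mulr2n addKr.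
have := pi_ge0 R => p0.
(* [Rintegral_period_le] expects the window that starts further left first; the sign of [c] decides
   which one that is. *)
have [c0|c0] := leP 0 c.
  by apply: Rintegral_period_le => //; rewrite ?mulr2n; lra.
by symmetry; apply: Rintegral_period_le => //; rewrite ?mulr2n; lra.
Qed.

Lemma Rintegral_circle_oppr {g} : bounded_measurable g ->
  \int[leb]_(x in `[- pi, pi[) g (- x) = \int[leb]_(x in `[- pi, pi[) g x.
Proof. by move=> bg; rewrite Rintegral_oppr// opprK. Qed.

End circle_integral.

(** * Fubini for real-valued integrals over rectangles *)

Section Rintegral_product.
Context {R : realType} {d1 d2 : measure_display}
  {T1 : measurableType d1} {T2 : measurableType d2}.
Variables (m1 : {sigma_finite_measure set T1 -> \bar R})
  (m2 : {sigma_finite_measure set T2 -> \bar R}) (A : set T1) (B : set T2)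
  (g : T1 * T2 -> R).
Hypotheses (mA : measurable A) (mB : measurable B)
  (m1A : (m1 A < +oo)%E) (m2B : (m2 B < +oo)%E) (bg : bounded_measurable g).

Lemma product_measure_setX_lty : ((m1 \x m2)%E (A `*` B) < +oo)%E.
Proof. by rewrite product_measure1E// lte_mul_pinfty// ge0_fin_numE. Qed.

Let ig : (m1 \x m2)%E.-integrable setT ((EFin \o g) \_ (A `*` B)).
Proof.
apply/(integrable_mkcond _ (measurableX mA mB)).
apply: bounded_measurable_integrable => //; first exact: measurableX.
exact: product_measure_setX_lty.
Qed.

(** Fubini is applied on the whole product space to [g] extended by zero off the rectangle. Slices
    outside [B] integrate to zero; the other inner integrals are finite, so reading them as reals
    through [fine] loses nothing. *)
Lemma Rintegral21_setX : \int[(m1 \x m2)%E]_(z in A `*` B) g z =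
  \int[m2]_(y in B) \int[m1]_(x in A) g (x, y).
Proof.
rewrite /Rintegral; congr fine.
rewrite integral_mkcond -integral21_prod_meas1// [RHS]integral_mkcond.
apply: eq_integral => y _; rewrite /fubini_G patchE.
have intg : m1.-integrable A (EFin \o (fun x => g (x, y))).
  apply: bounded_measurable_integrable => //.
  exact: (bounded_measurable_comp bg (pair2_measurable y)).
case: ifPn => yB.
  rewrite fineK; last exact: integrable_fin_num intg.
  rewrite [RHS]integral_mkcond; apply: eq_integral => x _.
  by rewrite !patchE /= in_setX/= yB andbT.
rewrite integral0_eq// => x _; rewrite patchE in_setX /=.
by rewrite (negbTE yB) andbF.
Qed.

Lemma Rintegral12_setX : \int[(m1 \x m2)%E]_(z in A `*` B) g z =
  \int[m1]_(x in A) \int[m2]_(y in B) g (x, y).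
Proof.
rewrite /Rintegral; congr fine.
rewrite integral_mkcond -integral12_prod_meas1// [RHS]integral_mkcond.
apply: eq_integral => x _; rewrite /fubini_F patchE.
have intg : m2.-integrable B (EFin \o (fun y => g (x, y))).
  apply: bounded_measurable_integrable => //.
  exact: (bounded_measurable_comp bg (pair1_measurable x)).
case: ifPn => xA.
  rewrite fineK; last exact: integrable_fin_num intg.
  rewrite [RHS]integral_mkcond; apply: eq_integral => y _.
  by rewrite !patchE /= in_setX/= xA.
rewrite integral0_eq// => y _; rewrite patchE in_setX /=.
by rewrite (negbTE xA).
Qed.

End Rintegral_product.

(* The library's instance for [\x] only recognizes products of subprobabilities
   as sigma-finite. *)
Lemma sigma_finite_product_measure {R : realType} {d1 d2 : measure_display}
    {T1 : measurableType d1} {T2 : measurableType d2}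
    (m1 : {sigma_finite_measure set T1 -> \bar R})
    (m2 : {sigma_finite_measure set T2 -> \bar R}) :
  sigma_finite setT (m1 \x m2)%E.
Proof.
have [F [FT ndF Foo]] := (sigma_finiteP _ _).1 (sigma_finiteT m1).
have [G [GT ndG Goo]] := (sigma_finiteP _ _).1 (sigma_finiteT m2).
exists (fun n => F n `*` G n) => [|n]; last first.
  have [[mF F_lty] [mG G_lty]] := (Foo n, Goo n).
  by split; [exact: measurableX|exact: product_measure_setX_lty].
apply/esym; rewrite -subTset => -[x y] _.
have [i _ Fix] : (\bigcup_i F i) x by rewrite -FT.
have [j _ Gjy] : (\bigcup_i G i) y by rewrite -GT.
exists (maxn i j) => //; split => /=.
  by move: x Fix; exact/subsetPset/ndF/leq_maxl.
by move: y Gjy; exact/subsetPset/ndG/leq_maxr.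
Qed.

(** * Integrals against densities and laws *)

(** The density formula passes from sets to integrands by the Radon-Nikodym theorem: [nu] is
    dominated by [mu], and its derivative is identified with [f] extended by zero off [D]. *)
Lemma Rintegral_density {R : realType} {d : measure_display}
    {T : measurableType d} {mu : {sigma_finite_measure set T -> \bar R}}
    {nu : {finite_measure set T -> \bar R}} {D : set T} {f h : T -> R} :
  measurable D -> (mu D < +oo)%E -> bounded_measurable f ->
  (forall A, measurable A -> nu A = (\int[mu]_(z in A `&` D) (f z)%:E)%E) ->
  bounded_measurable h ->
  \int[nu]_z h z = \int[mu]_(z in D) (h z * f z).
Proof.
move=> mD muD bf nuE bh.
have bounded_int g : bounded_measurable g -> mu.-integrable D (EFin \o g).
  exact: bounded_measurable_integrable.
have numu : nu `<< mu.
  apply/null_content_dominatesP => A mA muA.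
  rewrite nuE//; apply: null_set_integral.
  - exact: measurableI.
  - by apply/measurable_EFinP/measurable_funTS; case: bf.
  - apply/eqP; rewrite -measure_le0 -muA le_measure ?inE//.
    exact: measurableI.
have inth : nu.-integrable setT (EFin \o h).
  apply: bounded_measurable_integrable => //.
  by rewrite -ge0_fin_numE// fin_num_measure.
have mfD : measurable_fun setT ((EFin \o f) \_ D).
  apply/(measurable_restrictT _ mD)/measurable_EFinP/measurable_funTS.
  by case: bf.
rewrite /Rintegral -(Radon_Nikodym_change_of_variables numu)//; congr fine.
rewrite [RHS]integral_mkcond; apply: ae_eq_integral => //.
- apply: emeasurable_funM => //; apply: measurable_int inth.
- apply/(measurable_restrictT _ mD)/measurable_EFinP/measurable_funTS.
  by have [] := bounded_measurableM bh bf.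
- apply: (@ae_eq_trans _ _ _ _ _ _ _
    (fun z => (h z)%:E * ((EFin \o f) \_ D) z)%E).
    (* The derivative and the extended [f] both integrate to [nu E] over each measurable [E], so
       they agree almost everywhere. *)
    apply: ae_eqe_mul2l; rewrite Radon_NikodymE.
    case: cid => /= r [_ intr nur]; apply: integral_ae_eq => //.
    by move=> E _ mE; rewrite -nur// -integral_mkcondr; exact: nuE.
  apply: aeW => z _ /=; rewrite !patchE; case: ifP => // _.
  by rewrite mule0.
Qed.

Lemma Rintegral_distribution {R : realType} {d0 d : measure_display}
    {S : measurableType d0} {T : measurableType d} {P : probability T R}
    {Z : {RV P >-> S}} {f : S -> R} : bounded_measurable f ->
  \int[distribution P Z]_z f z = \int[P]_w f (Z w).
Proof.
move=> bf; rewrite /Rintegral integral_distribution//.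
  by apply/measurable_EFinP; case: bf.
apply: (@bounded_measurable_integrable _ _ _ P _ (fun w => f (Z w))) => //.
  by rewrite -ge0_fin_numE// fin_num_measure.
exact: (bounded_measurable_comp bf).
Qed.

(** * Independence and i.i.d. copies *)

Section independence.
Context {R : realType} {d0 : measure_display} {S : measurableType d0}
  {d : measure_display} {T : measurableType d} {P : probability T R}.
Implicit Types (f g : S -> R).

(** Independence makes the joint law agree with the product of the marginal laws on rectangles,
    hence everywhere by uniqueness of the product measure; Fubini then factors the integral. *)
Lemma Rintegral_independent {Z1 Z2 : {RV P >-> S}} {f g} :
  independent_rv Z1 Z2 -> bounded_measurable f -> bounded_measurable g ->
  \int[P]_w (f (Z1 w) * g (Z2 w)) =
  (\int[P]_w f (Z1 w)) * (\int[P]_w g (Z2 w)).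
Proof.
move=> ind bf bg; rewrite -!Rintegral_distribution//.
have mZ : measurable_fun setT (fun w => (Z1 w, Z2 w)).
  exact: measurable_fun_pair.
pose Z : {RV P >-> (S * S)%type} := HB.pack (fun w => (Z1 w, Z2 w))
  (isMeasurableFun.Build _ _ _ _ _ mZ).
have bfg : bounded_measurable (fun z : S * S => f z.1 * g z.2).
  apply: bounded_measurableM.
    exact: (bounded_measurable_comp bf).
  exact: (bounded_measurable_comp bg).
transitivity (\int[distribution P Z]_z (f z.1 * g z.2)).
  by rewrite Rintegral_distribution.
transitivity
  (\int[(distribution P Z1 \x distribution P Z2)%E]_(z in setT `*` setT)
    (f z.1 * g z.2)).
  rewrite setXTT; congr fine; apply: eq_measure_integral => A mA _.
  apply/esym/product_measure_unique => // B C mB mC; exact: ind.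
have lty (nu : probability S R) : (nu setT < +oo)%E.
  by rewrite -ge0_fin_numE// fin_num_measure.
rewrite Rintegral21_setX//=.
transitivity
  (\int[distribution P Z2]_y ((\int[distribution P Z1]_x f x) * g y)).
  apply: eq_Rintegral => y _; rewrite RintegralZr//.
  exact: (bounded_measurable_integrable measurableT (lty _) bf).
rewrite RintegralZl//.
exact: (bounded_measurable_integrable measurableT (lty _) bg).
Qed.

End independence.

(** The integral form of the Cauchy-Binet identity (Andréief) for 2 x 2 determinants. Expanding
    gives four terms, each factored by independence into moments of one copy; both products of the
    determinant arise twice, whence the factor 2. The moments are variables with equations so that
    known values can be supplied directly. *)
Lemma Rintegral_iid_minors {R : realType} {d d' d0 : measure_display}
    {T : measurableType d} {T' : measurableType d'} {S : measurableType d0}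
    {P : probability T R} {Q : probability T' R}
    {Z : {RV P >-> S}} {Z1 Z2 : {RV Q >-> S}} {a b c e : S -> R}
    {mac mbe mae mbc : R} :
  iid_copies Z Z1 Z2 -> bounded_measurable a -> bounded_measurable b ->
  bounded_measurable c -> bounded_measurable e ->
  \int[P]_w (a (Z w) * c (Z w)) = mac -> \int[P]_w (b (Z w) * e (Z w)) = mbe ->
  \int[P]_w (a (Z w) * e (Z w)) = mae -> \int[P]_w (b (Z w) * c (Z w)) = mbc ->
  \int[Q]_w ((a (Z1 w) * b (Z2 w) - b (Z1 w) * a (Z2 w)) *
             (c (Z1 w) * e (Z2 w) - e (Z1 w) * c (Z2 w))) =
  2 * (mac * mbe - mae * mbc).
Proof.
move=> [id1 id2 ind] ba bb bc be <- <- <- <-.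
have sameE (Z' : {RV Q >-> S}) f : same_distribution Z' Z ->
    bounded_measurable f -> \int[Q]_w f (Z' w) = \int[P]_w f (Z w).
  move=> id' bf; rewrite -!Rintegral_distribution//.
  by congr fine; apply: eq_measure_integral => A mA _; exact: id'.
have bM f g (bf : bounded_measurable f) (bg : bounded_measurable g) :
  bounded_measurable (fun z : S => f z * g z) := bounded_measurableM bf bg.
have prodE f g : bounded_measurable f -> bounded_measurable g ->
    \int[Q]_w (f (Z1 w) * g (Z2 w)) =
    (\int[P]_w f (Z w)) * (\int[P]_w g (Z w)).
  by move=> bf bg; rewrite Rintegral_independent// !sameE.
pose p f g (w : T') := f (Z1 w) * g (Z2 w) : R.
have bp f g : bounded_measurable f -> bounded_measurable g ->
    bounded_measurable (p f g).
  move=> bf bg; apply: bounded_measurableM.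
    exact: (bounded_measurable_comp bf).
  exact: (bounded_measurable_comp bg).
have intQ (f : T' -> R) : bounded_measurable f ->
    Q.-integrable setT (EFin \o f).
  move=> bf; apply: bounded_measurable_integrable => //.
  by rewrite -ge0_fin_numE// fin_num_measure.
pose ac z := a z * c z; pose be' z := b z * e z.
pose ae z := a z * e z; pose bc' z := b z * c z.
have [bac bbe bae bbc] : [/\ bounded_measurable ac, bounded_measurable be',
  bounded_measurable ae & bounded_measurable bc'] by split; exact: bM.
transitivity
  (\int[Q]_w ((p ac be' w + p be' ac w) - (p ae bc' w + p bc' ae w))).
  by apply: eq_Rintegral => w _; rewrite /p /ac /be' /ae /bc'; ring.
rewrite RintegralB//; [|by apply/intQ/bounded_measurableD; exact: bp..].
rewrite !RintegralD//; [|by apply/intQ/bp..].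
by rewrite !prodE//; ring.
Qed.

(** * Unnormalized moments of the sine model and their partial derivatives *)

Section von_mises_sine_integral.
Context {R : realType}.
Local Notation leb := (@lebesgue_measure R).
(* [lebesgue_measure] lives on [measurableTypeR R], whose display differs from
   that of [R]; the measurable sets are convertible. *)
Local Notation plane := (measurableTypeR R * measurableTypeR R)%type.
Implicit Types (h : plane -> R) (k : R).

(** The unnormalized moment of [h] at centred angles. As functions of the three parameters these
    moments form a family closed under partial derivatives, each of which only changes [h]. *)
Definition vms_integral h k1 k2 k3 : R :=
  \int[(leb \x leb)%E]_(z in @vms_support R)
    (h z * expR (vms_exponent k1 k2 k3 z.1 z.2)).

Lemma measurable_itv_measurableTypeR (i : interval R) :
  @measurable _ (measurableTypeR R) [set` i].
Proof. exact: measurable_itv. Qed.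

Lemma measurable_vms_support : @measurable _ plane (@vms_support R).
Proof. exact: measurableX. Qed.

Lemma vms_support_lty : ((leb \x leb)%E (@vms_support R) < +oo)%E.
Proof.
by apply: product_measure_setX_lty => //; exact: lebesgue_itv_lty.
Qed.

(* Exchanging the order of integration between the two changes of variable
   makes measurability of the inner integral unnecessary. *)
Lemma Rintegral_setX_change {A A' B B' : set (measurableTypeR R)} {h}
    {f g : measurableTypeR R -> measurableTypeR R} :
  measurable A -> measurable A' -> measurable B -> measurable B' ->
  (leb A < +oo)%E -> (leb A' < +oo)%E -> (leb B < +oo)%E -> (leb B' < +oo)%E ->
  measurable_fun setT f -> measurable_fun setT g -> bounded_measurable h ->
  (forall y, \int[leb]_(x in A) h (f x, y) = \int[leb]_(x in A') h (x, y)) ->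
  (forall x, \int[leb]_(y in B) h (x, g y) = \int[leb]_(y in B') h (x, y)) ->
  \int[(leb \x leb)%E]_(z in A `*` B) h (f z.1, g z.2) =
  \int[(leb \x leb)%E]_(z in A' `*` B') h z.
Proof.
move=> mA mA' mB mB' lA lA' lB lB' mf mg bh hA hB.
have bhg : bounded_measurable (fun z => h (z.1, g z.2)).
  apply: (bounded_measurable_comp bh); apply: measurable_fun_pair => //.
  exact: measurableT_comp mg _.
have bhfg : bounded_measurable (fun z => h (f z.1, g z.2)).
  apply: (bounded_measurable_comp bhg (g := fun z => (f z.1, z.2))).
  by apply: measurable_fun_pair => //; exact: measurableT_comp mf _.
rewrite Rintegral21_setX//=.
under eq_Rintegral do rewrite hA.
rewrite -(Rintegral21_setX leb leb A' B (fun z => h (z.1, g z.2)))//.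
rewrite Rintegral12_setX//=.
under eq_Rintegral do rewrite hB.
by rewrite -(Rintegral12_setX leb leb A' B' h).
Qed.

Lemma bounded_measurable_vms_exponent k1 k2 k3 :
  bounded_measurable (fun z : plane => vms_exponent k1 k2 k3 z.1 z.2).
Proof.
have bcst c : bounded_measurable (fun _ : plane => c).
  exact: bounded_measurable_cst.
apply: bounded_measurableD; last first.
  apply: bounded_measurableM => //.
  by apply: bounded_measurableM; exact: bounded_measurable_sin.
by apply: bounded_measurableD; apply: bounded_measurableM => //;
  exact: bounded_measurable_cos.
Qed.

Lemma bounded_measurable_vms_integrand h k1 k2 k3 : bounded_measurable h ->
  bounded_measurable (fun z => h z * expR (vms_exponent k1 k2 k3 z.1 z.2)).
Proof.
move=> bh; apply: bounded_measurableM => //; apply: bounded_measurable_expR.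
exact: bounded_measurable_vms_exponent.
Qed.

Lemma vms_integral_subr h g k1 k2 k3 :
  bounded_measurable h -> bounded_measurable g ->
  vms_integral (fun z => h z - g z) k1 k2 k3 =
  vms_integral h k1 k2 k3 - vms_integral g k1 k2 k3.
Proof.
move=> bh bg; rewrite -RintegralB//=.
- by apply: eq_Rintegral => z _; rewrite mulrBl.
- exact: measurable_vms_support.
- apply: (bounded_measurable_integrable measurable_vms_support vms_support_lty).
  exact: bounded_measurable_vms_integrand.
- apply: (bounded_measurable_integrable measurable_vms_support vms_support_lty).
  exact: bounded_measurable_vms_integrand.
Qed.

(** Reflecting both angles at once preserves the weight, because the two sign changes cancel in the
    product of sines; the integral therefore equals its own opposite. Reflecting one angle alone
    would flip the sign of the [k3] term. *)
Lemma vms_integral_odd h k1 k2 k3 : bounded_measurable h ->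
  (forall x y, h (- x, - y) = - h (x, y)) -> vms_integral h k1 k2 k3 = 0.
Proof.
move=> bh oddh; have := bounded_measurable_vms_integrand h k1 k2 k3 bh.
set F := fun z => _ => bF.
have cF y : bounded_measurable (fun x : R => F (x, y)).
  exact: (bounded_measurable_comp bF (pair2_measurable y)).
have cF' x : bounded_measurable (fun y : R => F (x, y)).
  exact: (bounded_measurable_comp bF (pair1_measurable x)).
have lty : (leb [set` `[- pi, pi[%R] < +oo)%E by exact: lebesgue_itv_lty.
have mI := @measurable_itv_measurableTypeR.
have mN : measurable_fun [set: measurableTypeR R]
    (-%R : measurableTypeR R -> measurableTypeR R) by exact: oppr_measurable.
have : vms_integral h k1 k2 k3 = - 1 * vms_integral h k1 k2 k3.
  rewrite -RintegralZl; last 2 first.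
  - exact: measurable_vms_support.
  - by apply: (bounded_measurable_integrable measurable_vms_support);
      [exact: vms_support_lty|].
  transitivity (\int[(leb \x leb)%E]_(z in @vms_support R) F (- z.1, - z.2)).
    rewrite /vms_integral /vms_support; symmetry.
    apply: (Rintegral_setX_change (mI _) (mI _) (mI _) (mI _) lty lty lty lty
      mN mN bF).
    - by move=> y; exact: (Rintegral_circle_oppr (cF y)).
    - by move=> x; exact: (Rintegral_circle_oppr (cF' x)).
  apply: eq_Rintegral => -[x y] _ /=; rewrite /F/= oddh.
  by rewrite /vms_exponent !sinN !cosN mulrNN mulN1r mulNr.
by move/eqP; rewrite mulN1r -subr_eq0 opprK -mulr2n mulrn_eq0 => /eqP.
Qed.

Lemma CsE k1 k2 k3 : Cs k1 k2 k3 = vms_integral (fun=> 1) k1 k2 k3.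
Proof.
have := bounded_measurable_vms_integrand (fun=> 1) k1 k2 k3
  (bounded_measurable_cst 1).
set F := fun z => _ => bF.
have lty b : (leb [set` Interval (BLeft (- pi)) (BSide b pi)]%R < +oo)%E.
  exact: lebesgue_itv_lty.
have mI := @measurable_itv_measurableTypeR.
have closedE (f : R -> R) : bounded_measurable f ->
    \int[leb]_(x in `[- pi, pi]) f x = \int[leb]_(x in `[- pi, pi[) f x.
  move=> bf; rewrite -Rintegral_itv_bndo_bndc//.
  by apply: bounded_measurable_integrable => //; exact: (lty true).
transitivity (\int[(leb \x leb)%E]_(z in `[- pi, pi] `*` `[- pi, pi]) F z).
  rewrite (Rintegral21_setX leb leb _ _ F (mI _) (mI _) (lty _) (lty _) bF).
  by apply: eq_Rintegral => p _; apply: eq_Rintegral => t _; rewrite /F mul1r.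
(* With identity maps, [Rintegral_setX_change] replaces the closed intervals by half-open ones, one
   coordinate at a time; the endpoints are null. *)
rewrite [LHS](_ : _ = \int[(leb \x leb)%E]_(z in `[- pi, pi] `*` `[- pi, pi])
  F (id z.1, id z.2)); last by apply: eq_Rintegral => -[].
rewrite /vms_integral /vms_support.
have mid : measurable_fun [set: measurableTypeR R]
    (id : measurableTypeR R -> measurableTypeR R) by exact: measurable_id.
apply: (Rintegral_setX_change (mI _) (mI _) (mI _) (mI _) (lty false) (lty true)
  (lty false) (lty true) mid mid bF).
- move=> y; apply: closedE.
  exact: (bounded_measurable_comp bF (pair2_measurable y)).
- move=> x; apply: closedE.
  exact: (bounded_measurable_comp bF (pair1_measurable x)).
Qed.

(** The exponent is affine in [k1] with slope [cos z.1]. The equality is between functions of all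
    three parameters, so higher and mixed partial derivatives follow by rewriting again. *)
Lemma partial1_vms_integral h : bounded_measurable h ->
  partial1 (vms_integral h) = vms_integral (fun z => h z * cos z.1).
Proof.
move=> bh; apply/funext => k1; apply/funext => k2; apply/funext => k3.
pose a (z : plane) := cos z.1.
pose b (z : plane) := k2 * cos z.2 + k3 * (sin z.1 * sin z.2).
have ba : bounded_measurable a by exact: bounded_measurable_cos.
have bb : bounded_measurable b.
  have -> : b = fun z => vms_exponent 0 k2 k3 z.1 z.2.
    by apply/funext => z; rewrite /vms_exponent mul0r add0r.
  exact: bounded_measurable_vms_exponent.
rewrite /partial1 (_ : (fun u => _) = fun u =>
    \int[(leb \x leb)%E]_(z in @vms_support R) (h z * expR (u * a z + b z))).
  rewrite (derive1_integral_expR _ measurable_vms_support vms_support_lty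
    bh ba bb).
  by apply: eq_Rintegral => z _; rewrite /vms_exponent addrA.
apply/funext => u; apply: eq_Rintegral => z _.
by rewrite /vms_exponent addrA.
Qed.

Lemma partial2_vms_integral h : bounded_measurable h ->
  partial2 (vms_integral h) = vms_integral (fun z => h z * cos z.2).
Proof.
move=> bh; apply/funext => k1; apply/funext => k2; apply/funext => k3.
pose a (z : plane) := cos z.2.
pose b (z : plane) := k1 * cos z.1 + k3 * (sin z.1 * sin z.2).
have ba : bounded_measurable a by exact: bounded_measurable_cos.
have bb : bounded_measurable b.
  have -> : b = fun z => vms_exponent k1 0 k3 z.1 z.2.
    by apply/funext => z; rewrite /vms_exponent mul0r addr0.
  exact: bounded_measurable_vms_exponent.
rewrite /partial2 (_ : (fun u => _) = fun u =>
    \int[(leb \x leb)%E]_(z in @vms_support R) (h z * expR (u * a z + b z))).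
  rewrite (derive1_integral_expR _ measurable_vms_support vms_support_lty
    bh ba bb).
  by apply: eq_Rintegral => z _; rewrite /vms_exponent addrCA addrA.
apply/funext => u; apply: eq_Rintegral => z _.
by rewrite /vms_exponent addrCA addrA.
Qed.

Lemma partial3_vms_integral h : bounded_measurable h ->
  partial3 (vms_integral h) = vms_integral (fun z => h z * (sin z.1 * sin z.2)).
Proof.
move=> bh; apply/funext => k1; apply/funext => k2; apply/funext => k3.
pose a (z : plane) := sin z.1 * sin z.2.
pose b (z : plane) := k1 * cos z.1 + k2 * cos z.2.
have ba : bounded_measurable a.
  by apply: bounded_measurableM; exact: bounded_measurable_sin.
have bb : bounded_measurable b.
  have -> : b = fun z => vms_exponent k1 k2 0 z.1 z.2.
    by apply/funext => z; rewrite /vms_exponent mul0r addr0.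
  exact: bounded_measurable_vms_exponent.
rewrite /partial3 (_ : (fun u => _) = fun u =>
    \int[(leb \x leb)%E]_(z in @vms_support R) (h z * expR (u * a z + b z))).
  rewrite (derive1_integral_expR _ measurable_vms_support vms_support_lty
    bh ba bb).
  by apply: eq_Rintegral => z _; rewrite /vms_exponent addrC.
apply/funext => u; apply: eq_Rintegral => z _.
by rewrite /vms_exponent addrC.
Qed.

(** The integrand has period [2 pi] in each angle and the square is a full period in each, so both
    translations can be undone, one coordinate at a time. *)
Lemma vms_integral_shift h k1 k2 k3 mu1 mu2 : bounded_measurable h ->
  (forall y, periodic (fun x : R => h (x, y)) (pi *+ 2)) ->
  (forall x, periodic (fun y : R => h (x, y)) (pi *+ 2)) ->
  - pi <= mu1 < pi -> - pi <= mu2 < pi ->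
  \int[(leb \x leb)%E]_(z in @vms_support R)
    (h (z.1 - mu1, z.2 - mu2) *
     expR (vms_exponent k1 k2 k3 (z.1 - mu1) (z.2 - mu2))) =
  vms_integral h k1 k2 k3.
Proof.
move=> bh h1 h2 hmu1 hmu2.
have := bounded_measurable_vms_integrand h k1 k2 k3 bh.
set F := fun z => _ => bF.
have cF y : bounded_measurable (fun x : R => F (x, y)).
  exact: (bounded_measurable_comp bF (pair2_measurable y)).
have cF' x : bounded_measurable (fun y : R => F (x, y)).
  exact: (bounded_measurable_comp bF (pair1_measurable x)).
have F1 y : periodic (fun x : R => F (x, y)) (pi *+ 2).
  by move=> x; rewrite /F /vms_exponent/= h1 sinD2pi cosD2pi.
have F2 x : periodic (fun y : R => F (x, y)) (pi *+ 2).
  by move=> y; rewrite /F /vms_exponent/= h2 sinD2pi cosD2pi.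
have lty : (leb [set` `[- pi, pi[%R] < +oo)%E by exact: lebesgue_itv_lty.
have mI := @measurable_itv_measurableTypeR.
have mshift (c : R) : measurable_fun [set: measurableTypeR R]
    (fun x : measurableTypeR R => x - c : measurableTypeR R).
  exact: measurable_funB.
rewrite /vms_integral /vms_support.
apply: (Rintegral_setX_change (mI _) (mI _) (mI _) (mI _) lty lty lty lty
  (mshift mu1) (mshift mu2) bF).
- by move=> y; exact: (Rintegral_circle_shift (cF y)).
- by move=> x; exact: (Rintegral_circle_shift (cF' x)).
Qed.

Lemma Rintegral_vms_distributed {d : measure_display} {T : measurableType d}
    {P : probability T R} {Z : {RV P >-> (R * R)%type}} {h k1 k2 k3 mu1 mu2} :
  vms_distributed Z k1 k2 k3 mu1 mu2 -> bounded_measurable h ->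
  (forall y, periodic (fun x : R => h (x, y)) (pi *+ 2)) ->
  (forall x, periodic (fun y : R => h (x, y)) (pi *+ 2)) ->
  - pi <= mu1 < pi -> - pi <= mu2 < pi ->
  \int[P]_w h ((Z w).1 - mu1, (Z w).2 - mu2) =
  (Cs k1 k2 k3)^-1 * vms_integral h k1 k2 k3.
Proof.
move=> hZ bh h1 h2 hmu1 hmu2.
(* The same map is retyped to land in [plane], where the product of the Lebesgue measures lives. *)
have mZ : measurable_fun setT (Z : T -> plane).
  exact: (@measurable_funPT _ _ _ _ Z).
pose Z' : {RV P >-> plane} := HB.pack (Z : T -> plane)
  (isMeasurableFun.Build _ _ _ _ _ mZ).
have mshift :
    measurable_fun setT (fun z : plane => (z.1 - mu1, z.2 - mu2) : plane).
  by apply: measurable_fun_pair => /=; apply: measurable_funB.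
have bshift (g : plane -> R) : bounded_measurable g ->
    bounded_measurable (fun z : plane => g (z.1 - mu1, z.2 - mu2)).
  by move=> bg; exact: (bounded_measurable_comp bg mshift).
(* [Rintegral_density] takes a bundled sigma-finite measure, so the product measure is packed with
   its proof of sigma-finiteness. *)
pose sigma_leb2 := sigma_finite_product_measure leb leb.
pose leb2 : {sigma_finite_measure set plane -> \bar R} := HB.pack_for
  (SigmaFiniteMeasure.type plane R) (leb \x leb)%E
  (isSFinite.Build _ _ _ _ (sfinite_measure_sigma_finite sigma_leb2))
  (isSigmaFinite.Build _ _ _ _ sigma_leb2).
have bdens : @bounded_measurable R _ plane (vms_density k1 k2 k3 mu1 mu2).
  apply: bounded_measurableM; first exact: bounded_measurable_cst.
  apply: bounded_measurable_expR.
  exact: (bshift _ (bounded_measurable_vms_exponent k1 k2 k3)).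
have := @Rintegral_distribution _ _ _ _ _ P Z' _ (bshift _ bh).
move=> /= <-.
rewrite (@Rintegral_density R _ plane leb2 (distribution P Z') _ _ _
  measurable_vms_support vms_support_lty bdens hZ (bshift _ bh)).
rewrite -(vms_integral_shift h k1 k2 k3 mu1 mu2)// -RintegralZl.
- by apply: eq_Rintegral => z _; rewrite /vms_density /= mulrCA.
- exact: measurable_vms_support.
- apply: (bounded_measurable_integrable measurable_vms_support vms_support_lty).
  exact: (bshift _ (bounded_measurable_vms_integrand h k1 k2 k3 bh)).
Qed.

End von_mises_sine_integral.

(** * Moments of the model and the circular coefficients *)

Lemma rexpectationE {R : realType} {d : measure_display}
    {T : measurableType d} (P : probability T R) (X : T -> R) :
  rexpectation P X = \int[P]_w X w.
Proof. by rewrite /rexpectation unlock. Qed.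

Theorem theorem2p1 (R : realType) (mu1 mu2 k1 k2 k3 : R)
    (hmu1 : - pi <= mu1 < pi) (hmu2 : - pi <= mu2 < pi)
    (hk1 : 0 <= k1) (hk2 : 0 <= k2)
    (d : measure_display) (T : measurableType d) (P : probability T R)
    (Z : {RV P >-> (R * R)%type})
    (hZ : vms_distributed Z k1 k2 k3 mu1 mu2) :
  let C := Cs k1 k2 k3 in
  let C_1 := partial1 (@Cs R) k1 k2 k3 in
  let C_2 := partial2 (@Cs R) k1 k2 k3 in
  let C_3 := partial3 (@Cs R) k1 k2 k3 in
  let C_11 := partial1 (partial1 (@Cs R)) k1 k2 k3 in
  let C_22 := partial2 (partial2 (@Cs R)) k1 k2 k3 in
  let C_12 := partial1 (partial2 (@Cs R)) k1 k2 k3 in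
  let Theta := fst \o Z in
  let Phi := snd \o Z in
  [/\ forall (d' : measure_display) (T' : measurableType d')
        (Q : probability T' R) (Z1 Z2 : {RV Q >-> (R * R)%type}),
        iid_copies Z Z1 Z2 ->
        fisher_lee Q (fst \o Z1) (snd \o Z1) (fst \o Z2) (snd \o Z2) =
        ((C^-1 * C_3) * (C^-1 * C_12)) /
        Num.sqrt ((C^-1 * C_11) * (1 - C^-1 * C_11) *
                  (C^-1 * C_22) * (1 - C^-1 * C_22)),
      jammalamadaka_sarma P mu1 mu2 Theta Phi =
        (C^-1 * C_3) /
        Num.sqrt ((1 - C^-1 * C_11) * (1 - C^-1 * C_22)),
      circular_variance P mu1 Theta = 1 - C^-1 * C_1
    & circular_variance P mu2 Phi = 1 - C^-1 * C_2].
Proof.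
move=> C C_1 C_2 C_3 C_11 C_22 C_12 Theta Phi.
pose plane := (measurableTypeR R * measurableTypeR R)%type.
have CE : @Cs R = vms_integral (fun=> 1).
  by apply/funext => x; apply/funext => y; apply/funext => z; rewrite CsE.
have b1 : @bounded_measurable R _ plane (fun=> 1).
  exact: bounded_measurable_cst.
have bc1 : @bounded_measurable R _ plane (fun z => cos z.1).
  exact: bounded_measurable_cos.
have bc2 : @bounded_measurable R _ plane (fun z => cos z.2).
  exact: bounded_measurable_cos.
have bs1 : @bounded_measurable R _ plane (fun z => sin z.1).
  exact: bounded_measurable_sin.
have bs2 : @bounded_measurable R _ plane (fun z => sin z.2).
  exact: bounded_measurable_sin.
have bM f g : @bounded_measurable R _ plane f ->
    @bounded_measurable R _ plane g ->
    @bounded_measurable R _ plane (fun z => f z * g z).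
  exact: bounded_measurableM.
pose V (h : plane -> R) := vms_integral h k1 k2 k3.
have VC : C = V (fun=> 1) by rewrite /C CE.
have VC1 : C_1 = V (fun z => cos z.1).
  rewrite /C_1 CE partial1_vms_integral//.
  by congr (vms_integral _ k1 k2 k3); apply/funext => z; rewrite mul1r.
have VC2 : C_2 = V (fun z => cos z.2).
  rewrite /C_2 CE partial2_vms_integral//.
  by congr (vms_integral _ k1 k2 k3); apply/funext => z; rewrite mul1r.
have VC3 : C_3 = V (fun z => sin z.1 * sin z.2).
  rewrite /C_3 CE partial3_vms_integral//.
  by congr (vms_integral _ k1 k2 k3); apply/funext => z; rewrite mul1r.
have VC11 : C_11 = V (fun z => cos z.1 * cos z.1).
  rewrite /C_11 CE !partial1_vms_integral//; last exact: bM.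
  by congr (vms_integral _ k1 k2 k3); apply/funext => z; rewrite mul1r.
have VC22 : C_22 = V (fun z => cos z.2 * cos z.2).
  rewrite /C_22 CE !partial2_vms_integral//; last exact: bM.
  by congr (vms_integral _ k1 k2 k3); apply/funext => z; rewrite mul1r.
have VC12 : C_12 = V (fun z => cos z.1 * cos z.2).
  rewrite /C_12 CE partial2_vms_integral// partial1_vms_integral//;
    last exact: bM.
  by congr (vms_integral _ k1 k2 k3); apply/funext => z; rewrite mul1r mulrC.
have E (h : plane -> R) : @bounded_measurable R _ plane h ->
    (forall y, periodic (fun x : R => h (x, y)) (pi *+ 2)) ->
    (forall x, periodic (fun y : R => h (x, y)) (pi *+ 2)) ->
    \int[P]_w h ((Z w).1 - mu1, (Z w).2 - mu2) = C^-1 * V h.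
  by move=> bh h1 h2; exact: (Rintegral_vms_distributed hZ bh h1 h2 hmu1 hmu2).
(* Otherwise unification unfolds the derivatives. *)
clearbody C C_1 C_2 C_3 C_11 C_22 C_12.
(* The total mass of [P] is one, so [E] at the constant 1 gives this identity, and with it that [C]
   is nonzero. *)
have C1 : C^-1 * C = 1.
  rewrite {2}VC -E// Rintegral_cst// mul1r.
  exact: (congr1 fine (probability_setT P)).
(* This is [sin ^+ 2 = 1 - cos ^+ 2] under the integral, with 1 written as [C^-1 * V (fun=> 1)]. *)
have Vs1 : C^-1 * V (fun z => sin z.1 * sin z.1) = 1 - C^-1 * C_11.
  rewrite -C1 [X in _ = _ * X - _]VC VC11 -mulrBr -vms_integral_subr//;
    last exact: bM.
  congr (_ * vms_integral _ k1 k2 k3); apply/funext => z.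
  by rewrite -!expr2 sin2cos2.
have Vs2 : C^-1 * V (fun z => sin z.2 * sin z.2) = 1 - C^-1 * C_22.
  rewrite -C1 [X in _ = _ * X - _]VC VC22 -mulrBr -vms_integral_subr//;
    last exact: bM.
  congr (_ * vms_integral _ k1 k2 k3); apply/funext => z.
  by rewrite -!expr2 sin2cos2.
have Ess : \int[P]_w (sin ((Z w).1 - mu1) * sin ((Z w).2 - mu2)) = C^-1 * C_3.
  rewrite VC3 -(E (fun z => sin z.1 * sin z.2))//;
    [exact: bM|by move=> ? ? /=; rewrite ?sinD2pi ?cosD2pi..].
have Ecc : \int[P]_w (cos ((Z w).1 - mu1) * cos ((Z w).2 - mu2)) = C^-1 * C_12.
  rewrite VC12 -(E (fun z => cos z.1 * cos z.2))//;
    [exact: bM|by move=> ? ? /=; rewrite ?sinD2pi ?cosD2pi..].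
have Ec1 : \int[P]_w (cos ((Z w).1 - mu1) * cos ((Z w).1 - mu1)) = C^-1 * C_11.
  rewrite VC11 -(E (fun z => cos z.1 * cos z.1))//;
    [exact: bM|by move=> ? ? /=; rewrite ?sinD2pi ?cosD2pi..].
have Ec2 : \int[P]_w (cos ((Z w).2 - mu2) * cos ((Z w).2 - mu2)) = C^-1 * C_22.
  rewrite VC22 -(E (fun z => cos z.2 * cos z.2))//;
    [exact: bM|by move=> ? ? /=; rewrite ?sinD2pi ?cosD2pi..].
have Es1 : \int[P]_w (sin ((Z w).1 - mu1) * sin ((Z w).1 - mu1)) =
    1 - C^-1 * C_11.
  rewrite -Vs1 -(E (fun z => sin z.1 * sin z.1))//;
    [exact: bM|by move=> ? ? /=; rewrite ?sinD2pi ?cosD2pi..].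
have Es2 : \int[P]_w (sin ((Z w).2 - mu2) * sin ((Z w).2 - mu2)) =
    1 - C^-1 * C_22.
  rewrite -Vs2 -(E (fun z => sin z.2 * sin z.2))//;
    [exact: bM|by move=> ? ? /=; rewrite ?sinD2pi ?cosD2pi..].
have Esc : \int[P]_w (sin ((Z w).1 - mu1) * cos ((Z w).2 - mu2)) = 0.
  rewrite (E (fun z => sin z.1 * cos z.2))//;
    [|exact: bM|by move=> ? ? /=; rewrite ?sinD2pi ?cosD2pi..].
  rewrite /V vms_integral_odd ?mulr0//; first exact: bM.
  by move=> x y /=; rewrite sinN cosN mulNr.
have Esc1 : \int[P]_w (sin ((Z w).1 - mu1) * cos ((Z w).1 - mu1)) = 0.
  rewrite (E (fun z => sin z.1 * cos z.1))//;
    [|exact: bM|by move=> ? ? /=; rewrite ?sinD2pi ?cosD2pi..].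
  rewrite /V vms_integral_odd ?mulr0//; first exact: bM.
  by move=> x y /=; rewrite sinN cosN mulNr.
have Esc2 : \int[P]_w (sin ((Z w).2 - mu2) * cos ((Z w).2 - mu2)) = 0.
  rewrite (E (fun z => sin z.2 * cos z.2))//;
    [|exact: bM|by move=> ? ? /=; rewrite ?sinD2pi ?cosD2pi..].
  rewrite /V vms_integral_odd ?mulr0//; first exact: bM.
  by move=> x y /=; rewrite sinN cosN mulNr.
split; last 2 first.
- rewrite /circular_variance rexpectationE VC1 -(E (fun z => cos z.1))//.
  by move=> ? ? /=; rewrite cosD2pi.
- rewrite /circular_variance rexpectationE VC2 -(E (fun z => cos z.2))//.
  by move=> ? ? /=; rewrite cosD2pi.
- move=> d' T' Q Z1 Z2 iid; rewrite /fisher_lee !rexpectationE.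
  pose a (z : R * R) := sin (z.1 - mu1); pose b (z : R * R) := cos (z.1 - mu1).
  pose c (z : R * R) := sin (z.2 - mu2); pose e (z : R * R) := cos (z.2 - mu2).
  have m1 : measurable_fun setT (fun z : R * R => z.1 - mu1).
    exact: measurable_funB.
  have m2 : measurable_fun setT (fun z : R * R => z.2 - mu2).
    exact: measurable_funB.
  have ba : bounded_measurable a := bounded_measurable_sin m1.
  have bb : bounded_measurable b := bounded_measurable_cos m1.
  have bc : bounded_measurable c := bounded_measurable_sin m2.
  have be : bounded_measurable e := bounded_measurable_cos m2.
  (* Centring both copies at [mu1] leaves their difference unchanged, so the subtraction formula
     applies to the centred angles. *)
  have sin1 w : sin ((fst \o Z1) w - (fst \o Z2) w) =
      a (Z1 w) * b (Z2 w) - b (Z1 w) * a (Z2 w).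
    by rewrite -sinB /=; congr sin; ring.
  have sin2 w : sin ((snd \o Z1) w - (snd \o Z2) w) =
      c (Z1 w) * e (Z2 w) - e (Z1 w) * c (Z2 w).
    by rewrite -sinB /=; congr sin; ring.
  under eq_Rintegral do rewrite sin1 sin2.
  under [X in Num.sqrt (X * _)]eq_Rintegral do rewrite sin1 expr2.
  under [X in Num.sqrt (_ * X)]eq_Rintegral do rewrite sin2 expr2.
  (* In each of the three determinants [erefl] leaves the fourth moment unevaluated: it is
     multiplied by the third, which is zero. *)
  rewrite (Rintegral_iid_minors iid ba bb bc be Ess Ecc Esc erefl).
  rewrite (Rintegral_iid_minors iid ba bb ba bb Es1 Ec1 Esc1 erefl).
  rewrite (Rintegral_iid_minors iid bc be bc be Es2 Ec2 Esc2 erefl).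
  rewrite !mul0r !subr0.
  set x := C^-1 * C_11; set y := C^-1 * C_22.
  (* The two factors 2 leave the root as a single 2, which cancels the one in the numerator. Nothing
     else is cancelled, so a vanishing radicand is covered too, with the inverse of zero read as
     zero. *)
  have -> : 2 * ((1 - x) * x) * (2 * ((1 - y) * y)) =
      2 ^+ 2 * (x * (1 - x) * y * (1 - y)) by ring.
  rewrite sqrtrM ?sqr_ge0// sqrtr_sqr ger0_norm// invfM.
  by rewrite mulrACA divff ?mul1r// pnatr_eq0.
- rewrite /jammalamadaka_sarma !rexpectationE Ess.
  (* A square is convertible with the product of two equal factors, so [Es1] and [Es2] close the
     goals. *)
  by congr (_ / Num.sqrt (_ * _)).
Qed.
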